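(* Let $n \ge 1$ and let $T_1=([n], E_1)$ and $T_2=([n], E_2)$ be two tournaments on the same vertex set $[n]$. Then there is a vertex $\mu \in [n]$ such that $i \Rightarrow \mu$ for every $i \in [n]$; that is, for every $i\in[n]$ at least one of the following holds: $i=\mu$, or $(i,\mu)\in E_1$, or $(i,\mu)\in E_2$, or there exists $k\in[n]$ with $(i,k)\in E_1$ and $(k,\mu)\in E_2$.
   Context: $[n]=\{1,\dots,n\}$. A tournament $T=([n],E)$ is a directed graph without loops on vertex set $[n]$ such that for every two distinct vertices $i,j$ exactly one of $(i,j)$, $(j,i)$ belongs to $E$. The tournaments $T_1$ and $T_2$ are arbitrary and need not be related. For $i,j\in[n]$, the relation $i\Rightarrow j$ (with respect to the ordered pair $(T_1,T_2)$) means: $i=j$, or $(i,j)\in E_1$, or $(i,j)\in E_2$, or there exists $k$ such that $(i,k)\in E_1$ and $(k,j)\in E_2$. *)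

(* Defs.v *)
From mathcomp Require Import all_boot.

Set Implicit Arguments.
Unset Strict Implicit.
Unset Printing Implicit Defensive.

(* The vertex set {1, ..., n} is represented by 'I_n, and an edge set by its
   boolean adjacency relation: E i j iff (i, j) is an edge. *)
Definition tournament (n : nat) (E : rel 'I_n) : Prop :=
  (forall i : 'I_n, ~~ E i i) /\
  (forall i j : 'I_n, i != j -> E i j (+) E j i).

Definition arrow (n : nat) (E1 E2 : rel 'I_n) (i j : 'I_n) : Prop :=
  [\/ i = j, E1 i j, E2 i j | exists k : 'I_n, E1 i k /\ E2 k j].

(* Main.v *)
(** If no vertex [mu] works, each [j] has some [f j] with [f j => j] false, so
    the closed out-neighbourhood of [f j] in T1 lies in the open
    out-neighbourhood of [j] in T2. This persists after restriction to a nonempty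
    set [A] permuted by [f]; summing over [A] contradicts the fact that two
    tournaments on [A] have the same number of edges. *)
Require Import Defs.
From mathcomp Require Import all_boot.

Set Implicit Arguments.
Unset Strict Implicit.
Unset Printing Implicit Defensive.

Lemma arrowP (n : nat) (E1 E2 : rel 'I_n) (i j : 'I_n) :
  reflect (arrow E1 E2 i j)
    [|| i == j, E1 i j, E2 i j | [exists k, E1 i k && E2 k j]].
Proof.
apply: (iffP or4P) => -[].
- by move/eqP; constructor 1.
- by constructor 2.
- by constructor 3.
- by case/existsP=> k /andP[Eik Ekj]; constructor 4; exists k.
- by move/eqP; constructor 1.
- by constructor 2.
- by constructor 3.
- by case=> k [Eik Ekj]; constructor 4; apply/existsP; exists k; rewrite Eik.
Qed.

Lemma permuted_subset (T : finType) (f : T -> T) (x0 : T) :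
  exists2 A : {set T}, A != set0 & f @: A = A.
Proof.
pose P (A : {set T}) := (A != set0) && (f @: A \subset A).
have PT : P setT by rewrite /P subsetT andbT; apply/set0Pn; exists x0.
have [A /minsetP[/andP[A0 fA] minA] _] := minset_exists PT.
exists A => //; apply: minA => //; rewrite /P imset_eq0 A0.
exact: imsetS.
Qed.

Lemma tournament_edges (n : nat) (E : rel 'I_n) (A : {set 'I_n}) :
  tournament E ->
  (\sum_(i in A) #|[set k in A | E i k]|).*2
    = \sum_(i in A) \sum_(k in A) (i != k).
Proof.
case=> irrE totE.
have -> : \sum_(i in A) #|[set k in A | E i k]|
          = \sum_(i in A) \sum_(k in A) E i k.
  apply: eq_bigr => i _; rewrite -sum1_card big_mkcond [RHS]big_mkcond /=.
  by apply: eq_bigr => k _; rewrite inE; case: (k \in A); case: (E i k).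
rewrite -addnn {2}exchange_big -big_split; apply: eq_bigr => i _ /=.
rewrite -big_split; apply: eq_bigr => k _ /=.
have [<-|/totE] := eqVneq i k; first by rewrite (negPf (irrE i)).
by case: (E i k); case: (E k i).
Qed.

Lemma not_arrow_proper (n : nat) (E1 E2 : rel 'I_n) (A : {set 'I_n})
    (i j : 'I_n) :
  tournament E1 -> tournament E2 -> i \in A -> ~ arrow E1 E2 i j ->
  [set k in A | E1 i k] \proper [set k in A | E2 j k].
Proof.
move=> [irr1 _] [_ tot2] Ai /arrowP; rewrite !negb_or => /and4P[ij nE1 nE2 nex].
apply/properP; split; last first.
  exists i; rewrite !inE Ai ?(irr1 i) //=.
  by move: (tot2 _ _ ij); rewrite (negPf nE2).
apply/subsetP=> k; rewrite !inE => /andP[-> Eik] /=.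
have kj : k != j by apply: contraNneq nE1 => <-.
have nEkj : ~~ E2 k j.
  by apply: contra nex => Ekj; apply/existsP; exists k; rewrite Eik.
by move: (tot2 _ _ kj); rewrite (negPf nEkj).
Qed.

Theorem corollary2 (n : nat) (E1 E2 : rel 'I_n) (hn : 0 < n)
    (hT1 : tournament E1) (hT2 : tournament E2) :
  exists mu : 'I_n, forall i : 'I_n, arrow E1 E2 i mu.
Proof.
pose b (i j : 'I_n) := [|| i == j, E1 i j, E2 i j | [exists k, E1 i k && E2 k j]].
have [/existsP[mu /forallP mub]|/existsPn nomu] :=
  boolP [exists mu, [forall i, b i mu]].
  by exists mu => i; apply/arrowP/mub.
have /fin_all_exists[f nf] (j : 'I_n) : exists i, ~ arrow E1 E2 i j.
  by have /forallPn[i nb] := nomu j; exists i => /arrowP; apply/negP.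
have [A A0 fA] := permuted_subset f (Ordinal hn).
have injf : {in A &, injective f} by apply/imset_injP; rewrite fA.
pose d (E : rel 'I_n) (i : 'I_n) := #|[set k in A | E i k]|.
have lt_d : \sum_(j in A) (d E1 (f j)).+1 <= \sum_(j in A) d E2 j.
  apply: leq_sum => j Aj; apply/proper_card/not_arrow_proper => //.
  by rewrite -fA imset_f.
have eq_d : \sum_(j in A) d E1 j = \sum_(j in A) d E2 j.
  by apply: double_inj; rewrite !tournament_edges.
have sum_f : \sum_(j in A) d E1 (f j) = \sum_(j in A) d E1 j.
  by rewrite -[in RHS]fA big_imset.
move: lt_d; under eq_bigr do rewrite -addn1.
by rewrite big_split /= sum_f eq_d sum1_card -{2}[\sum_(_ in A) _]addn0
           leq_add2l leqn0 cards_eq0 (negPf A0).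
Qed.
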